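(* The following statements are equivalent: (1) For every periodic abelian ring $R$, the matrix ring $\mathbb{M}_2(R)$ is a periodic ring. (2) For every periodic local ring $R$, the matrix ring $\mathbb{M}_2(R)$ is a periodic ring. (3) Köthe's Conjecture has a positive solution for all algebras over finite fields.
   Context: All rings (except the algebras appearing in Köthe's Conjecture, which need not be unital) are associative with identity and not necessarily commutative. A ring $R$ is periodic if for every $x\in R$ there exist distinct positive integers $m\neq n$ with $x^m=x^n$. A ring is abelian if all its idempotents are central. A ring $R$ is local if $R/J(R)$ is a division ring, where $J(R)$ is the Jacobson radical. An algebra (or ideal) is nil if each of its elements is nilpotent. Köthe's Conjecture for algebras over a field $F$ is the assertion that every $F$-algebra without nonzero nil two-sided ideals has no nonzero nil one-sided ideals; a standard equivalent form is that for every nil $F$-algebra $A$ the matrix algebra $\mathbb{M}_2(A)$ is nil. Statement (3) says that this assertion holds for every finite field $F$. *)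

(* Defs.v *)
From mathcomp Require Import all_boot all_algebra.
From mathcomp Require Import boolp classical_sets.

Set Implicit Arguments.
Unset Strict Implicit.
Unset Printing Implicit Defensive.

Import GRing.Theory.

Local Open Scope classical_set_scope.
Local Open Scope ring_scope.

(* Rings are [pzRingType]: associative, unital, not necessarily commutative.
   The zero ring is allowed; it is periodic and abelian, but not local. *)

Definition periodic_ring (R : pzRingType) : Prop :=
  forall x : R, exists m n : nat,
    [/\ (0 < m)%N, (0 < n)%N, m <> n & x ^+ m = x ^+ n].

Definition abelian_ring (R : pzRingType) : Prop :=
  forall e : R, e * e = e -> forall x : R, e * x = x * e.

Definition left_ideal (R : pzRingType) (I : set R) : Prop :=
  [/\ I 0, forall x y, I x -> I y -> I (x - y)
    & forall a x, I x -> I (a * x)].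

Definition maximal_left_ideal (R : pzRingType) (M : set R) : Prop :=
  [/\ left_ideal M, M <> setT
    & forall I, left_ideal I -> M `<=` I -> I = M \/ I = setT].

Definition jacobson_radical (R : pzRingType) : set R :=
  \bigcap_(M in @maximal_left_ideal R) M.

Arguments jacobson_radical : clear implicits.

(* [R / J(R)] is a division ring, written on representatives (MathComp has no
   quotients of noncommutative rings): the class of 1 is nonzero and every
   nonzero class has a two-sided inverse. *)
Definition local_ring (R : pzRingType) : Prop :=
  ~ jacobson_radical R 1 /\
  forall x : R, ~ jacobson_radical R x ->
    exists y : R, jacobson_radical R (x * y - 1) /\
                  jacobson_radical R (y * x - 1).

(* Associative algebras over a field, not necessarily unital. *)
Record nuAlgebra (F : fieldType) : Type := NuAlgebra {
  nu_sort :> lmodType F;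
  nu_mul : nu_sort -> nu_sort -> nu_sort;
  nu_mulA : associative nu_mul;
  nu_mulDl : left_distributive nu_mul +%R;
  nu_mulDr : right_distributive nu_mul +%R;
  nu_scaleAl : forall (a : F) (x y : nu_sort),
    a *: nu_mul x y = nu_mul (a *: x) y;
  nu_scaleAr : forall (a : F) (x y : nu_sort),
    a *: nu_mul x y = nu_mul x (a *: y)
}.

(* The exponent is shifted, as there is no unit: [nu_powS x n] is the product
   of [n.+1] copies of [x]. *)
Definition nu_powS (F : fieldType) (A : nuAlgebra F) (x : A) (n : nat) : A :=
  iter n (nu_mul x) x.

Definition nu_nilpotent (F : fieldType) (A : nuAlgebra F) (x : A) : Prop :=
  exists n : nat, nu_powS x n = 0.

(* Ideals of an algebra are linear subspaces; this is not automatic in the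
   absence of a unit. *)
Definition nu_subspace (F : fieldType) (A : nuAlgebra F) (I : set A) : Prop :=
  I 0 /\ forall (a : F) (x y : A), I x -> I y -> I (a *: x + y).

Definition nu_left_ideal (F : fieldType) (A : nuAlgebra F) (I : set A) : Prop :=
  nu_subspace I /\ forall a x : A, I x -> I (nu_mul a x).

Definition nu_right_ideal (F : fieldType) (A : nuAlgebra F) (I : set A) : Prop :=
  nu_subspace I /\ forall a x : A, I x -> I (nu_mul x a).

Definition nu_ideal (F : fieldType) (A : nuAlgebra F) (I : set A) : Prop :=
  nu_left_ideal I /\ nu_right_ideal I.

Definition nu_nil (F : fieldType) (A : nuAlgebra F) (I : set A) : Prop :=
  forall x : A, I x -> nu_nilpotent x.

Definition kothe_conjecture (F : fieldType) : Prop :=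
  forall A : nuAlgebra F,
    (forall I : set A, nu_ideal I -> nu_nil I -> I = [set 0]) ->
    forall I : set A, nu_left_ideal I \/ nu_right_ideal I -> nu_nil I ->
      I = [set 0].

(* Main.v *)
(* A periodic ring is local iff 1 <> 0 and each element is nilpotent or of finite
   multiplicative order; its nilpotent elements then form a two-sided ideal N.

   (2) => (1): if X is a matrix over R that is not periodic, let I be an ideal
   maximal among those modulo which X is still not periodic. Idempotents of R are
   central, and X is periodic modulo I + eR and I + (1 - e)R as soon as these are
   larger than I; hence e or 1 - e lies in I and R/I is local.

   (2) => (3): for a nil left ideal L of an F-algebra, F + L is periodic and local.
   If x = l0 + l1 a with l0, l1 in L, then x is the product of the row (l0, l1) and
   the column (1, a), whose product in the other order lies in M_2(L); the latter
   is nil because M_2(F + L) is periodic, so L + La is nil. A maximal nil left ideal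
   is thus two-sided.

   (3) => (2): R/N is a division ring in which every nonzero element has finite
   order, so it is commutative and every matrix over it is periodic. By Koethe's
   conjecture, the matrices over N supported in the first column lie in the upper
   nilradical of M_2(R), which therefore contains M_2(N). So for X in M_2(R) some
   X^m - X^n is nilpotent, and Z[X] is finite because R has nonzero
   characteristic. *)
Require Import Defs.
From HB Require Import structures.
From mathcomp Require Import all_boot all_algebra all_field.
From mathcomp Require Import boolp classical_sets.

Set Implicit Arguments.
Unset Strict Implicit.
Unset Printing Implicit Defensive.

Import GRing.Theory.

Local Open Scope classical_set_scope.
Local Open Scope quotient_scope.
Local Open Scope ring_scope.

Definition two_sided_ideal (R : pzRingType) (I : set R) : Prop :=
  left_ideal I /\ forall a x, I x -> I (x * a).

Lemma left_idealN (R : pzRingType) (I : set R) x : left_ideal I -> I x -> I (- x).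
Proof. by case=> I0 IB _ Ix; rewrite -[- x]add0r; apply: IB. Qed.

Lemma left_idealD (R : pzRingType) (I : set R) x y :
  left_ideal I -> I x -> I y -> I (x + y).
Proof.
move=> idI Ix Iy; rewrite -[y]opprK; case: (idI) => _ IB _.
by apply: IB => //; apply: left_idealN.
Qed.

(** * Quotients, subrings and Zorn's lemma *)

(** The additive quotient is multiplied through chosen representatives [r q]. The product does not
    depend on the choice because [I] absorbs multiplication on both sides. *)
Lemma quotient_ring_exists (R : pzRingType) (I : set R) : two_sided_ideal I ->
  exists (Q : pzRingType) (pi : {rmorphism R -> Q}),
    (forall q, exists x, pi x = q) /\ (forall x, pi x = 0 <-> I x).
Proof.
move=> [idI Ir]; have [I0 IB Il] := idI.
pose P : pred R := fun x => `[< I x >].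
have PE x : (x \in P) = `[< I x >] by [].
have PB : zmod_closed P.
  by split=> [|x y]; rewrite !PE; [apply/asboolP|move=> /asboolP Ix /asboolP Iy;
    apply/asboolP/IB].
pose S : zmodClosed R := HB.pack P (GRing.isZmodClosed.Build R P PB).
pose Q0 : zmodType := Quotient.quot S.
pose pi : R -> Q0 := \pi_(Quotient.quot S).
have piE x y : pi x = pi y <-> I (x - y).
  split=> [/eqP|Ixy]; first by rewrite -Quotient.idealrBE => /asboolP.
  by apply/eqP; rewrite -Quotient.idealrBE; apply/asboolP.
have piB : zmod_morphism pi by move=> x y; rewrite /pi raddfB.
pose r (q : Q0) : R := repr q.
have rK q : pi (r q) = q by rewrite /pi /r reprK.
pose m (q q' : Q0) := pi (r q * r q').
have piM x y : pi (x * y) = m (pi x) (pi y).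
  apply/piE.
  have -> : x * y - r (pi x) * r (pi y) =
      (x - r (pi x)) * y + r (pi x) * (y - r (pi y)).
    by rewrite mulrBl mulrBr addrA subrK.
  apply: left_idealD => //; first by apply/Ir/piE; rewrite rK.
  by apply/Il/piE; rewrite rK.
have mA : associative m.
  by move=> x y z; rewrite -(rK x) -(rK y) -(rK z) -!piM mulrA.
have m1 : left_id (pi 1) m by move=> x; rewrite -(rK x) -!piM mul1r.
have mr1 : right_id (pi 1) m by move=> x; rewrite -(rK x) -!piM mulr1.
have piD x y : pi (x + y) = pi x + pi y by rewrite /pi raddfD.
have mDl : left_distributive m +%R.
  by move=> x y z; rewrite -(rK x) -(rK y) -(rK z) -piD -!piM -piD mulrDl.
have mDr : right_distributive m +%R.
  by move=> x y z; rewrite -(rK x) -(rK y) -(rK z) -piD -!piM -piD mulrDr.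
pose Q : pzRingType := HB.pack (GRing.Zmodule.sort Q0)
  (GRing.Zmodule_isPzRing.Build Q0 mA m1 mr1 mDl mDr).
pose piQ : R -> Q := pi.
have piQM : monoid_morphism piQ by split=> [|x y] //; exact: piM.
pose f : {rmorphism R -> Q} := HB.pack piQ (GRing.isZmodMorphism.Build R Q piQ piB)
  (GRing.isMonoidMorphism.Build R Q piQ piQM).
exists Q, f; split=> [q|x]; first by exists (r q); exact: rK.
have -> : f x = pi x by [].
have -> : (0 : Q) = pi 0 by rewrite /pi raddf0.
by rewrite piE subr0.
Qed.

Lemma subring_exists (S : pzRingType) (P : set S) :
  P 1 -> (forall x y, P x -> P y -> P (x - y)) ->
  (forall x y, P x -> P y -> P (x * y)) ->
  exists (Q : pzRingType) (iota : {rmorphism Q -> S}),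
    injective iota /\ forall x, P x <-> exists q, iota q = x.
Proof.
move=> P1 PB PM.
pose p : pred S := fun x => `[< P x >].
have pE x : (x \in p) = `[< P x >] by [].
have pS : subring_closed p.
  split=> [|x y|x y]; rewrite !pE; first exact/asboolP.
    by move=> /asboolP Px /asboolP Py; apply/asboolP/PB.
  by move=> /asboolP Px /asboolP Py; apply/asboolP/PM.
pose T : subChoiceType p := {x | p x}.
pose Q : subPzRingType p :=
  HB.pack (SubChoice.sort T)
    (GRing.SubChoice_isSubPzRing.Build S p (SubChoice.sort T) pS).
exists Q, (val : {rmorphism Q -> S}); split=> [|x]; first exact: val_inj.
split=> [Px|[q <-]]; last exact/asboolP/(valP q).
have sx : x \in p by apply/asboolP.
by exists (Sub x sx : T); exact: SubK.
Qed.

(** Zorn's lemma is applied to the sets [A] with [P (A]|[A0)]: the empty chain then yields [A0]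
    itself, so [P] need only be closed under unions of nonempty chains. *)
Lemma Zorn_above (T : Type) (P : set (set T)) (A0 : set T) :
  P A0 ->
  (forall F : set (set T), F !=set0 -> F `<=` P -> total_on F subset ->
     P (\bigcup_(X in F) X)) ->
  exists M, [/\ P M, A0 `<=` M & forall B, M `<=` B -> P B -> B = M].
Proof.
move=> PA0 PU.
have [F FP Ftot|A [PA maxA]] := @Zorn_bigcup T [set A | P (A `|` A0)].
  have [->|/set0P F0] := eqVneq F set0; first by rewrite /= bigcup_set0 set0U.
  rewrite /=; have -> : \bigcup_(X in F) X `|` A0 =
      \bigcup_(Y in [set X `|` A0 | X in F]) Y.
    apply/seteqP; split=> x.
      case=> [[X FX Xx]|A0x]; first by exists (X `|` A0); [exists X|left].
      by case: F0 => X FX; exists (X `|` A0); [exists X|right].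
    by case=> _ [X FX <-] [Xx|A0x]; [left; exists X|right].
  apply: PU.
  - by case: F0 => X FX; exists (X `|` A0), X.
  - by move=> _ [X FX <-]; apply: FP.
  - move=> _ _ [X FX <-] [Y FY <-].
    by case: (Ftot _ _ FX FY) => XY; [left|right]; apply: setSU.
exists (A `|` A0); split=> [||B sAB PB] //.
have sA0B : A0 `<=` B by apply: subset_trans sAB; apply: subsetUr.
have PB' : P (B `|` A0) by rewrite (setUidl sA0B).
apply/seteqP; split=> //; apply: contrapT => nBA; apply: (maxA B) => //; split.
  by apply: subset_trans sAB; apply: subsetUl.
by move=> BA; apply: nBA; apply: subset_trans BA (@subsetUl _ _ _).
Qed.

(** * Periodic local rings *)

Definition nilpotent_elt (R : pzRingType) (x : R) : Prop := exists k, x ^+ k = 0.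

Definition nil_or_torsion (R : pzRingType) : Prop :=
  1 <> 0 :> R /\
  forall x : R, nilpotent_elt x \/ exists2 k, (0 < k)%N & x ^+ k = 1.

Lemma nilpotent_eltP (R : pzRingType) (x : R) :
  nilpotent_elt x -> exists2 k, (0 < k)%N & forall j, (k <= j)%N -> x ^+ j = 0.
Proof.
case=> k xk; exists k.+1 => // j /ltnW kj.
by rewrite -(subnKC kj) exprD xk mul0r.
Qed.

Lemma nilpotent_fixed0 (R : pzRingType) (x y : R) :
  nilpotent_elt x -> x * y = y -> y = 0.
Proof.
case=> k xk xy; have E j : x ^+ j * y = y.
  by elim: j => [|j IH]; rewrite ?mul1r // exprSr -mulrA xy.
by rewrite -(E k) xk mul0r.
Qed.

Lemma nilpotent_unit (R : pzRingType) (x : R) : nilpotent_elt x ->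
  exists2 u, u * (1 - x) = 1 & (1 - x) * u = 1.
Proof.
case=> k xk; exists (\sum_(i < k) x ^+ i).
  transitivity (1 - x ^+ k); last by rewrite xk subr0.
  elim: k {xk} => [|k IH]; first by rewrite big_ord0 mul0r subrr.
  by rewrite big_ord_recr /= mulrDl IH mulrBr mulr1 -exprSr addrA subrK.
transitivity (1 - x ^+ k); last by rewrite xk subr0.
elim: k {xk} => [|k IH]; first by rewrite big_ord0 mulr0 subrr.
by rewrite big_ord_recr /= mulrDr IH mulrBl mul1r -exprS addrA subrK.
Qed.

(** Here [m] bounds the preperiod and [d] is a multiple of the period. *)
Definition periodic_elt (R : pzRingType) (x : R) : Prop :=
  exists m d, [/\ (0 < m)%N, (0 < d)%N & x ^+ m = x ^+ (m + d)].

Lemma pow_collision (R : pzRingType) (x : R) m n :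
  m <> n -> x ^+ m = x ^+ n -> periodic_elt x.
Proof.
move=> /eqP; rewrite neq_ltn => /orP[mn|nm] E.
  exists m.+1, (n - m)%N; rewrite subn_gt0 mn; split=> //.
  by rewrite addSn subnKC ?(ltnW mn) // !exprS E.
exists n.+1, (m - n)%N; rewrite subn_gt0 nm; split=> //.
by rewrite addSn subnKC ?(ltnW nm) // !exprS E.
Qed.

Lemma periodic_ringP (R : pzRingType) :
  periodic_ring R <-> forall x : R, periodic_elt x.
Proof.
split=> perR x; first by have [m [n [_ _ mn E]]] := perR x; apply: pow_collision E.
have [m [d [m0 d0 E]]] := perR x; exists m, (m + d)%N; split=> //.
  by rewrite addn_gt0 m0.
by move=> /eqP; rewrite -[X in X == _]addn0 eqn_add2l eq_sym -leqn0 leqNgt d0.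
Qed.

Lemma pow_periodic (R : pzRingType) (x : R) m d j t :
  x ^+ m = x ^+ (m + d) -> (m <= j)%N -> x ^+ (j + t * d) = x ^+ j.
Proof.
move=> xmd mj; elim: t => [|t IH]; first by rewrite addn0.
by rewrite mulSn [(d + _)%N]addnC addnA exprD IH -(subnK mj) -exprD -addnA exprD
  -xmd -exprD.
Qed.

Lemma idempotent_pow (R : pzRingType) (x : R) : periodic_elt x ->
  exists2 k, (0 < k)%N & x ^+ k * x ^+ k = x ^+ k.
Proof.
(* The exponent is past the preperiod and a multiple of the period, so doubling it leaves the power
   unchanged. *)
case=> m [d [m0 d0 E]]; exists (m * d)%N; first by rewrite muln_gt0 m0.
by rewrite -exprD (pow_periodic _ E) // leq_pmulr.
Qed.

Lemma nil_or_torsion_periodic (R : pzRingType) :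
  nil_or_torsion R -> periodic_ring R.
Proof.
case=> _ RP; apply/periodic_ringP => x; case: (RP x) => [[k xk]|[k k0 xk]].
  by apply: (@pow_collision _ _ k k.+1); [exact: n_Sn|rewrite exprS xk mulr0].
apply: (@pow_collision _ _ 0 k); last by rewrite xk.
by move=> k1; rewrite -k1 in k0.
Qed.

Lemma nilpotent_nlinv (R : pzRingType) (x u : R) :
  1 <> 0 :> R -> u * x = 1 -> ~ nilpotent_elt x.
Proof.
move=> R1 ux [k xk]; apply: R1; have <- : u ^+ k * x ^+ k = 1.
  elim: k {xk} => [|k IH]; first by rewrite mulr1.
  by rewrite exprSr exprS mulrA -[u ^+ k * u * x]mulrA ux mulr1.
by rewrite xk mulr0.
Qed.

Lemma nil_or_torsion_idempotent (R : pzRingType) (e : R) :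
  nil_or_torsion R -> e * e = e -> e = 0 \/ e = 1.
Proof.
case=> _ RP ee; have E k : (0 < k)%N -> e ^+ k = e.
  by case: k => // k _; elim: k => // k IH; rewrite exprS IH.
case: (RP e) => [/nilpotent_eltP[k k0 /(_ k (leqnn k))]|[k k0]]; rewrite E //.
  by left.
by right.
Qed.

(** Otherwise [(r * x) ^+ k.+1 = 1], and [(r * x) ^+ k * r] is a left inverse of the nilpotent
    [x]. *)
Lemma nilpotent_mull (R : pzRingType) (r x : R) :
  nil_or_torsion R -> nilpotent_elt x -> nilpotent_elt (r * x).
Proof.
case=> R1 RP nx; case: (RP (r * x)) => // -[[//|k] _].
by rewrite exprSr mulrA => /(nilpotent_nlinv R1).
Qed.

Lemma nilpotent_mulC (R : pzRingType) (x y : R) :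
  nilpotent_elt (x * y) -> nilpotent_elt (y * x).
Proof.
case=> k xyk; exists k.+1.
have -> : (y * x) ^+ k.+1 = y * (x * y) ^+ k * x.
  elim: k {xyk} => [|k IH]; first by rewrite expr0 mulr1 expr1.
  by rewrite exprS IH exprS !mulrA.
by rewrite xyk mulr0 mul0r.
Qed.

Lemma nilpotent_two_sided (R : pzRingType) :
  nil_or_torsion R -> two_sided_ideal (@nilpotent_elt R).
Proof.
move=> tR; have [R1 RP] := tR.
have nN (x : R) : nilpotent_elt x -> nilpotent_elt (- x).
  by move=> nx; rewrite -mulN1r; apply: nilpotent_mull.
split; last by move=> a x nx; apply: nilpotent_mulC; apply: nilpotent_mull.
split; [by exists 1%N| |by move=> a x; apply: nilpotent_mull].
move=> x y nx ny; case: (RP (x - y)) => // -[[//|k] _].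
(* From [v * (x - y) = 1] one gets [v * x = 1 + v * y], which is a unit because [v * y] is
   nilpotent; but [v * x] is nilpotent as well. *)
rewrite exprSr; set v := _ ^+ k; rewrite mulrBr => /eqP; rewrite subr_eq => /eqP E.
have /nilpotent_unit[u _] : nilpotent_elt (- (v * y)) by apply/nN/nilpotent_mull.
rewrite opprK -E => vxu.
have /nilpotent_mulC [j] : nilpotent_elt (u * (v * x)).
  by apply/nilpotent_mull/nilpotent_mull.
by rewrite vxu expr1n.
Qed.

Lemma torsion_idempotent (R : pzRingType) (x : R) : periodic_elt x ->
  (forall e : R, e * e = e -> e = 0 \/ e = 1) ->
  nilpotent_elt x \/ exists2 k, (0 < k)%N & x ^+ k = 1.
Proof.
move=> /idempotent_pow[k k0 ek] /(_ _ ek)[xk|xk]; first by left; exists k.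
by right; exists k.
Qed.

(** * Maximal left ideals and the Jacobson radical *)

Lemma left_ideal_full (R : pzRingType) (I : set R) :
  left_ideal I -> I 1 -> I = setT.
Proof. by move=> [_ _ Il] I1; apply/seteqP; split=> // x _; rewrite -[x]mulr1;
  apply: Il. Qed.

Lemma maximal_left_ideal_exists (R : pzRingType) (I : set R) :
  left_ideal I -> ~ I 1 -> exists2 M, maximal_left_ideal M & I `<=` M.
Proof.
move=> idI nI1.
have [||M [[idM nM1] IM maxM]] :=
    @Zorn_above _ [set J : set R | left_ideal J /\ ~ J 1] I.
- by [].
- move=> F [J0 FJ0] FP Ftot; split; last by case=> J FJ J1; case: (FP _ FJ).
  split; first by exists J0 => //; case: (FP _ FJ0) => -[].
    move=> x y [J FJ Jx] [K FK Ky].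
    have [[_ JB _] _] := FP _ FJ; have [[_ KB _] _] := FP _ FK.
    by case: (Ftot _ _ FJ FK) => S; [exists K|exists J] => //;
      [apply: KB|apply: JB] => //; apply: S.
  by move=> a x [J FJ Jx]; exists J => //; have [[_ _ Jl] _] := FP _ FJ; apply: Jl.
exists M => //; split=> // [MT|J idJ MJ]; first by apply: nM1; rewrite MT.
have [J1|nJ1] := pselect (J 1); [right; exact: left_ideal_full|left].
exact: maxM.
Qed.

(** If the left ideal generated by [1 + x] were proper, a maximal left ideal would contain both
    [1 + x] and [x], hence 1. *)
Lemma jacobson_linv (R : pzRingType) (x : R) :
  jacobson_radical R x -> exists u, u * (1 + x) = 1.
Proof.
move=> Jx; pose I : set R := [set y | exists u, y = u * (1 + x)].
have idI : left_ideal I.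
  split; first by exists 0; rewrite mul0r.
    by move=> _ _ [u ->] [v ->]; exists (u - v); rewrite mulrBl.
  by move=> a _ [u ->]; exists (a * u); rewrite mulrA.
have [[u]|nI1] := pselect (I 1); first by exists u.
have [M maxM IM] := maximal_left_ideal_exists idI nI1.
have [idM MT _] := maxM; case: MT; apply: left_ideal_full => //.
have -> : 1 = (1 + x) - x :> R by rewrite addrK.
case: (idM) => _ MB _; apply: MB; last exact: Jx.
by apply: IM; exists 1; rewrite mul1r.
Qed.

Lemma jacobson_left_ideal (R : pzRingType) : left_ideal (jacobson_radical R).
Proof.
split=> [M [[]] //|x y Jx Jy M maxM|a x Jx M maxM].
  by have [[_ MB _] _ _] := maxM; apply: MB; [apply: Jx|apply: Jy].
by have [[_ _ Ml] _ _] := maxM; apply: Ml; apply: Jx.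
Qed.

(** Some power of each element is idempotent, so it suffices that idempotents are trivial. If [e]
    lies in the radical, [1 - e] has a left inverse and kills [e]; otherwise [e] has a left inverse
    and kills [e - 1]. *)
Lemma local_nil_or_torsion (R : pzRingType) :
  periodic_ring R -> local_ring R -> nil_or_torsion R.
Proof.
move=> /periodic_ringP perR [nJ1 Rinv].
have R1 : 1 <> 0 :> R by move=> R1; apply: nJ1; rewrite R1;
  case: (jacobson_left_ideal R).
split=> // x; apply: torsion_idempotent => // e ee.
have [Je|nJe] := pselect (jacobson_radical R e).
  have [u u1] := jacobson_linv (left_idealN (jacobson_left_ideal R) Je).
  by left; rewrite -[e]mul1r -[X in X * _]u1 -mulrA mulrBl mul1r ee subrr mulr0.
have [y [_ /jacobson_linv[u]]] := Rinv _ nJe.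
rewrite addrC subrK => u1; right.
apply/eqP; rewrite -subr_eq0 -[e - 1]mul1r -[X in X * _]u1 -!mulrA mulrBr mulr1 ee
  subrr.
by rewrite !mulr0.
Qed.

(** A proper left ideal contains no element of finite order, so the nilpotent elements form the
    unique maximal left ideal, which is then the Jacobson radical. *)
Lemma nil_or_torsion_local (R : pzRingType) : nil_or_torsion R -> local_ring R.
Proof.
move=> tR; have [R1 RP] := tR; have [idN _] := nilpotent_two_sided tR.
have proper I : left_ideal I -> ~ I 1 -> I `<=` @nilpotent_elt R.
  move=> idI nI1 x Ix; case: (RP x) => // -[[//|k] _ xk]; case: nI1.
  by rewrite -xk exprSr; case: idI => _ _; apply.
have nN1 : ~ nilpotent_elt (1 : R) by case=> k; rewrite expr1n.
have maxN : maximal_left_ideal (@nilpotent_elt R).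
  split=> //; first by move=> NT; apply: nN1; rewrite NT.
  move=> I idI NI; have [I1|nI1] := pselect (I 1); [right;
    exact: left_ideal_full|left].
  by apply/seteqP; split=> //; apply: proper.
have JN x : jacobson_radical R x <-> nilpotent_elt x.
  split=> [|nx M maxM]; first exact.
  have [idM MT Mmax] := maxM; have nM1 : ~ M 1 by move=> /(left_ideal_full idM).
  by case: (Mmax _ idN (proper _ idM nM1)) => [<- //|NT]; case: nN1; rewrite NT.
split=> [/JN //|x nJx]; case: (RP x) => [/JN //|[[//|k] _ xk]].
exists (x ^+ k); rewrite -exprS -exprSr xk subrr.
by split; apply/JN; exists 1%N.
Qed.

(** * From local to abelian periodic rings *)

Lemma map_mxX (R Q : pzRingType) (f : {rmorphism R -> Q}) n (X : 'M[R]_n) k :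
  map_mx f (X ^+ k) = map_mx f X ^+ k.
Proof. by elim: k => [|k IH]; rewrite ?map_mx1 // !exprS -IH map_mxM. Qed.

Lemma map_mx_eq0_entries (R Q : pzRingType) (f : {rmorphism R -> Q}) (I : set R) n
    (X : 'M[R]_n) : (forall x, f x = 0 <-> I x) ->
  (map_mx f X = 0) <-> forall a b, I (X a b).
Proof.
move=> fI; split=> [E a b|IX]; first by apply/fI; move/matrixP/(_ a b): E;
  rewrite !mxE.
by apply/matrixP=> a b; rewrite !mxE; apply/fI.
Qed.

(** A single congruence is spread to all exponents past the preperiod and all multiples of the
    period, so that periods modulo two different ideals can be combined. *)
Lemma pow_collision_mod (R : pzRingType) (I : set R) n (X : 'M[R]_n) m l :
  two_sided_ideal I -> m <> l -> (forall a b, I ((X ^+ m - X ^+ l) a b)) ->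
  exists m d, (0 < d)%N /\ forall j t, (m <= j)%N ->
    forall a b, I ((X ^+ (j + t * d) - X ^+ j) a b).
Proof.
move=> idI ml; have [Q [f [_ fI]]] := quotient_ring_exists idI.
move=> /(map_mx_eq0_entries (X ^+ m - X ^+ l) fI).2.
rewrite map_mxB !map_mxX => /eqP; rewrite subr_eq0 => /eqP /(pow_collision ml).
case=> m' [d [_ d0 E]]; exists m', d; split=> // j t mj.
apply/(map_mx_eq0_entries _ fI); rewrite map_mxB !map_mxX.
by rewrite (pow_periodic _ E) // subrr.
Qed.

(** Used to place all entries of a matrix in a single ideal of a chain. *)
Lemma chain_bigcup_finite (T : Type) (K : finType) (F : set (set T)) (f : K -> T) :
  F !=set0 -> total_on F subset -> (forall k, (\bigcup_(J in F) J) (f k)) ->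
  exists2 J, F J & forall k, J (f k).
Proof.
move=> F0 Ftot Ff.
have [J FJ Js] : exists2 J, F J & forall k, k \in enum K -> J (f k).
  elim: (enum K) => [|k s [J FJ Js]]; first by case: F0 => J FJ; exists J.
  have [L FL Lk] := Ff k.
  case: (Ftot _ _ FJ FL) => S; [exists L|exists J] => // h;
    rewrite inE => /predU1P[->|hs] //.
  - by apply/S/Js.
  - exact: S.
  - exact: Js.
by exists J => // k; apply: Js; rewrite mem_enum.
Qed.

Lemma periodic_abelian_of_local (R : pzRingType) :
  (forall Q : pzRingType, periodic_ring Q -> local_ring Q -> periodic_ring 'M[Q]_2) ->
  periodic_ring R -> abelian_ring R -> periodic_ring 'M[R]_2.
Proof.
move=> H /periodic_ringP perR abR; apply/periodic_ringP => X.
pose bad (I : set R) := two_sided_ideal I /\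
  ~ exists m n, m <> n /\ forall a b, I ((X ^+ m - X ^+ n) a b).
apply: contrapT => nperX.
have [||I [[idI nXI] _ maxI]] := @Zorn_above _ bad [set 0].
- split.
    split; last by move=> a x /= ->; rewrite mul0r.
    by split=> [//|x y /= -> ->|a x /= ->]; rewrite ?subrr ?mulr0.
  case=> m [n [mn E]]; apply: nperX; apply: (pow_collision mn).
  by apply/eqP; rewrite -subr_eq0; apply/eqP/matrixP=> a b; rewrite E mxE.
- move=> F F0 FP Ftot; split.
    split; [split|].
    + by case: F0 => J FJ; exists J => //; have [[[]]] := FP _ FJ.
    + move=> x y [J FJ Jx] [K FK Ky].
      have [[[_ JB _] _] _] := FP _ FJ; have [[[_ KB _] _] _] := FP _ FK.
      by case: (Ftot _ _ FJ FK) => S; [exists K|exists J] => //;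
        [apply: KB|apply: JB] => //; apply: S.
    + by move=> a x [J FJ Jx]; exists J => //; have [[[_ _ Jl] _] _] := FP _ FJ;
        apply: Jl.
    + by move=> a x [J FJ Jx]; exists J => //; have [[_ Jr] _] := FP _ FJ; apply: Jr.
  case=> m [n [mn E]].
  have [|J FJ Jf] := @chain_bigcup_finite _ ('I_2 * 'I_2)%type F
     (fun k => (X ^+ m - X ^+ n) k.1 k.2) F0 Ftot; first by move=> k; apply: E.
  have [_] := FP _ FJ; apply; exists m, n; split=> // a b; exact: (Jf (a, b)).
have [idlI Ir] := idI; have [I0 IB Il] := idlI.
(* This is [I + eR], a two-sided ideal since [e] is central. *)
pose J e := [set y | exists i r, I i /\ y = i + e * r].
have JI e : (forall x, e * x = x * e) -> I `<=` J e /\ two_sided_ideal (J e).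
  move=> ce; split; first by move=> i Ii; exists i, 0; rewrite mulr0 addr0.
  split; [split|].
  - by exists 0, 0; rewrite mulr0 addr0.
  - move=> _ _ [i [r [Ii ->]]] [j [s [Ij ->]]]; exists (i - j), (r - s).
    by split; [exact: IB|rewrite mulrBr opprD addrACA].
  - move=> a _ [i [r [Ii ->]]]; exists (a * i), (a * r).
    by split; [exact: Il|rewrite mulrDr !mulrA ce].
  - move=> a _ [i [r [Ii ->]]]; exists (i * a), (r * a).
    by split; [exact: Ir|rewrite mulrDl mulrA].
have Je e : (forall x, e * x = x * e) -> ~ I e -> exists m d, (0 < d)%N /\
    forall j t, (m <= j)%N -> forall a b, J e ((X ^+ (j + t * d) - X ^+ j) a b).
  move=> ce nIe; have [IJ idJ] := JI e ce.
  have [[m [n [mn E]]]|nX] := pselect (exists m n, m <> n /\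
      forall a b, J e ((X ^+ m - X ^+ n) a b));
        first exact: (pow_collision_mod idJ mn E).
  case: nIe; rewrite -(maxI _ IJ); last by split.
  by exists 0, 1; rewrite add0r mulr1.
have Iidem e : e * e = e -> I e \/ I (1 - e).
  move=> ee; have ce := abR _ ee.
  have [Ie|nIe] := pselect (I e); first by left.
  have [Ie'|nIe'] := pselect (I (1 - e)); [by right|exfalso].
  have ce' x : (1 - e) * x = x * (1 - e) by rewrite mulrBl mulrBr mul1r mulr1 ce.
  have [m1 [d1 [d10 E1]]] := Je _ ce nIe.
  have [m2 [d2 [d20 E2]]] := Je _ ce' nIe'.
  (* These exponents are past both preperiods and differ by a common multiple of both periods, so
     the entries [y] below lie in both [J e] and [J (1 - e)]. *)
  apply: nXI; exists (m1 + m2 + d1 * d2)%N, (m1 + m2)%N; split.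
    move/eqP; rewrite -[X in _ == X]addn0 eqn_add2l => /eqP /eqP.
    by rewrite muln_eq0 !eqn0Ngt d10 d20.
  move=> a b; set y := (X in I X).
  have [i [r [Ii yE]]] : J e y by rewrite /y mulnC; apply: E1; rewrite leq_addr.
  have [j [s [Ij yE']]] : J (1 - e) y by apply: E2; rewrite leq_addl.
  (* Multiplication by [e] kills [(1 - e)R] and multiplication by [1 - e] kills [eR], so both
     summands fall into [I]. *)
  have -> : y = e * y + (1 - e) * y by rewrite -mulrDl addrC subrK mul1r.
  apply: left_idealD => //.
    by rewrite yE' mulrDr mulrA mulrBr mulr1 ee subrr mul0r addr0; apply: Il.
  by rewrite yE mulrDr mulrA [(1 - e) * e]mulrBl mul1r ee subrr mul0r addr0;
    apply: Il.
have [Q [f [fsurj fI]]] := quotient_ring_exists idI.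
have tQ : nil_or_torsion Q.
  split=> [Q1|q].
    (* In a zero quotient [I] is the whole ring, and any two powers of [X] are congruent. *)
    apply: nXI; exists 0%N, 1%N; split=> // a b.
    rewrite -[_ a b]mul1r; apply: Ir; apply/fI; by rewrite rmorph1.
  have [x <-] := fsurj q; have [k k0 ek] := idempotent_pow (perR x).
  case: (Iidem _ ek) => /fI; rewrite ?rmorphB ?rmorph1 rmorphXn.
    by move=> xk; left; exists k.
  by move=> /eqP; rewrite subr_eq0 => /eqP xk; right; exists k.
have perM := H _ (nil_or_torsion_periodic tQ) (nil_or_torsion_local tQ).
have [m [n [_ _ mn]]] := perM (map_mx f X).
rewrite -!map_mxX => /eqP; rewrite -subr_eq0 -map_mxB => /eqP E.
by apply: nXI; exists m, n; split=> //; apply/(map_mx_eq0_entries _ fI).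
Qed.

(** * Finite subrings *)

(** A finite subring, given by a list of its elements; finiteness is what yields collisions among
    powers. *)
Definition subring_seq (R : pzRingType) (s : seq R) : Prop :=
  [/\ 1 \in s, {in s &, forall x y, x - y \in s} & {in s &, forall x y, x * y \in s}].

Lemma subring_seq0 (R : pzRingType) (s : seq R) : subring_seq s -> 0 \in s.
Proof. by case=> s1 sB _; rewrite -(subrr 1); apply: sB. Qed.

Lemma subring_seqD (R : pzRingType) (s : seq R) :
  subring_seq s -> {in s &, forall x y, x + y \in s}.
Proof.
move=> sS x y sx sy; have [_ sB _] := sS.
by rewrite -[y]opprK; apply: (sB) => //; rewrite -sub0r; apply: sB => //;
  apply: subring_seq0.
Qed.

Lemma subring_seq_sum (R : pzRingType) (s : seq R) (I : finType) (F : I -> R) :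
  subring_seq s -> (forall i, F i \in s) -> \sum_i F i \in s.
Proof.
move=> sS sF; apply: (big_ind (fun x => x \in s)) => //; first exact: subring_seq0.
exact: subring_seqD.
Qed.

Lemma prime_subring_seq (R : pzRingType) M : (0 < M)%N -> M%:R = 0 :> R ->
  exists2 s : seq R, subring_seq s & forall x, x \in s <-> exists n, x = n%:R.
Proof.
move=> M0 MR; pose s : seq R := mkseq (fun n => n%:R) M.
have sP x : x \in s <-> exists n, x = n%:R.
  split=> [/mapP[n _ ->]|[n ->]]; first by exists n.
  apply/mapP; exists (n %% M)%N; first by rewrite mem_iota ltn_mod.
  by rewrite {1}(divn_eq n M) natrD natrM MR mulr0 add0r.
exists s => //; split=> [|x y|x y]; first by apply/sP; exists 1%N.
  (* Since [M] vanishes in [R], [m * M.-1] represents the opposite of [m]. *)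
  move=> /sP[n ->] /sP[m ->]; apply/sP; exists (n + m * M.-1)%N.
  rewrite natrD; congr (_ + _); apply/eqP.
  by rewrite eq_sym -addr_eq0 -natrD addnC -mulnS prednK // natrM MR mulr0.
by move=> /sP[n ->] /sP[m ->]; apply/sP; exists (n * m)%N; rewrite natrM.
Qed.

(* The sums of the x_i g^i with i < K and x_i in s already form a ring, since
   g s is contained in s g. *)
Lemma adjoin_subring_seq (R : pzRingType) (s : seq R) (g : R) K (c : 'I_K -> R) :
  subring_seq s -> (forall x, x \in s -> exists2 y, y \in s & g * x = y * g) ->
  (forall i, c i \in s) -> g ^+ K = \sum_(i < K) c i * g ^+ i ->
  exists V : seq R, [/\ subring_seq V, {subset s <= V}, g \in V
    & forall v, v \in V -> exists2 x : 'I_K -> R,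
        forall i, x i \in s & v = \sum_(i < K) x i * g ^+ i].
Proof.
move=> sS gs sc gK; have [s1 sB sM] := sS; have s0 := subring_seq0 sS.
pose V := [seq \sum_(i < K) val (f i) * g ^+ i | f : {ffun 'I_K -> seq_sub s}].
have VP v : v \in V <-> exists2 x : 'I_K -> R,
    forall i, x i \in s & v = \sum_(i < K) x i * g ^+ i.
  split=> [/mapP[f _ ->]|[x sx ->]].
    by exists (fun i => val (f i)) => // i; apply: valP.
  apply/mapP; exists [ffun i => SeqSub (sx i)]; first by rewrite mem_enum.
  by apply: eq_bigr => i _; rewrite ffunE.
have VB : {in V &, forall v w, v - w \in V}.
  move=> _ _ /VP[x sx ->] /VP[y sy ->]; apply/VP; exists (fun i => x i - y i).
    by move=> i; apply: sB.
  by rewrite -sumrB; apply: eq_bigr => i _; rewrite mulrBl.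
have sV : {in s & V, forall x v, x * v \in V}.
  move=> x _ sx /VP[y sy ->]; apply/VP; exists (fun i => x * y i).
    by move=> i; apply: (sM).
  by rewrite mulr_sumr; apply: eq_bigr => i _; rewrite mulrA.
(* The bound includes [K], where the given relation enters: multiplying a combination of the
   [g ^+ i] with [i < K] by [g] raises exponents to at most [K]. *)
have Vpow j : (j <= K)%N -> g ^+ j \in V.
  rewrite leq_eqVlt => /predU1P[->|jK]; first by apply/VP; exists c.
  apply/VP; exists (fun i => (i == Ordinal jK)%:R); first by move=> i; case: eqP.
  rewrite (bigD1 (Ordinal jK)) //= eqxx mul1r big1 ?addr0 // => i /negPf ->.
  by rewrite mul0r.
have V1 : 1 \in V by rewrite -(expr0 g); apply: Vpow.
have V0 : 0 \in V by rewrite -(subrr 1); apply: VB.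
have VD : {in V &, forall v w, v + w \in V}.
  by move=> v w Vv Vw; rewrite -[w]opprK; apply: (VB) => //; rewrite -sub0r;
    apply: VB.
have Vsum (F : 'I_K -> R) : (forall i, F i \in V) -> \sum_i F i \in V.
  by move=> VF; apply: (big_ind (fun x => x \in V)).
have gV v : v \in V -> g * v \in V.
  move=> /VP[x sx ->]; rewrite mulr_sumr; apply: Vsum => i.
  have [y sy gx] := gs _ (sx i).
  by rewrite mulrA gx -mulrA -exprS; apply: sV => //; apply: Vpow.
have gjV j v : v \in V -> g ^+ j * v \in V.
  by move=> Vv; elim: j => [|j IH]; rewrite ?mul1r // exprS -mulrA; apply: gV.
have VM : {in V &, forall v w, v * w \in V}.
  move=> _ w /VP[x sx ->] Vw; rewrite mulr_suml; apply: Vsum => i.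
  by rewrite -mulrA; apply: sV => //; apply: gjV.
exists V; split=> // [x sx||v /VP //]; first by rewrite -[x]mulr1; apply: sV.
by rewrite -[g]mulr1; apply: gV.
Qed.

Lemma adjoin_periodic (R : pzRingType) (s : seq R) (g : R) :
  subring_seq s -> (forall x, x \in s -> exists2 y, y \in s & g * x = y * g) ->
  periodic_elt g ->
  exists V : seq R, [/\ subring_seq V, {subset s <= V}, g \in V
    & forall v, v \in V -> exists K (x : 'I_K -> R),
        (forall i, x i \in s) /\ v = \sum_(i < K) x i * g ^+ i].
Proof.
move=> sS gs [m [d [m0 d0 E]]]; have [s1 _ _] := sS; have s0 := subring_seq0 sS.
have mK : (m < m + d)%N by rewrite -[X in (X < _)%N]addn0 ltn_add2l.
(* The relation is [g ^+ (m + d) = g ^+ m], with the single coefficient 1 at index [m]. *)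
have [||V [VS sV Vg VP]] := @adjoin_subring_seq _ s g (m + d)
    (fun i => (i == Ordinal mK)%:R) sS gs; first by move=> i; case: eqP.
  rewrite (bigD1 (Ordinal mK)) //= eqxx mul1r -E big1 ?addr0 // => i /negPf ->.
  by rewrite mul0r.
exists V; split=> // v /VP[x sx ->]; by exists (m + d)%N, x.
Qed.

Lemma seq_collision (T : eqType) (f : nat -> T) (s : seq T) :
  (forall n, f n \in s) -> exists m n, m <> n /\ f m = f n.
Proof.
move=> fs; apply: contrapT => inj.
have finj : injective f.
  by move=> m n E; apply: contrapT => mn; apply: inj; exists m, n.
have := uniq_leq_size (_ : uniq (mkseq f (size s).+1))
  (_ : {subset mkseq f (size s).+1 <= s}).
rewrite size_mkseq ltnn => /(_ _ _)/notF; apply.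
  by rewrite map_inj_uniq // iota_uniq.
by move=> _ /mapP[n _ ->].
Qed.

Lemma subring_seq_pow (R : pzRingType) (s : seq R) x k :
  subring_seq s -> x \in s -> x ^+ k \in s.
Proof. by case=> s1 _ sM sx; elim: k => // k IH; rewrite exprS; apply: sM. Qed.

Lemma subring_seq_periodic (R : pzRingType) (s : seq R) x :
  subring_seq s -> x \in s -> periodic_elt x.
Proof.
move=> sS sx; have [m [n [mn E]]] := seq_collision (fun k => subring_seq_pow k sS sx).
exact: pow_collision E.
Qed.

(** Two equal powers of the element 2 differ by a positive integer that vanishes in [R]. *)
Lemma periodic_char (R : pzRingType) : periodic_ring R ->
  exists2 M, (0 < M)%N & M%:R = 0 :> R.
Proof.
move=> /periodic_ringP/(_ 2%:R)[m [d [_ d0 E]]].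
exists (2 ^ (m + d) - 2 ^ m)%N.
  by rewrite subn_gt0 ltn_exp2l // -[X in (X < _)%N]addn0 ltn_add2l.
by rewrite natrB ?leq_exp2l ?leq_addr // !natrX -E subrr.
Qed.

(* With u = x^m - x^n nilpotent and, say, n < m, the relation x^m = x^n + u makes
   x integral over the finite ring Z[u], so Z[u][x] is finite. *)
Lemma periodic_of_nilpotent_diff (R : pzRingType) M (x : R) m n :
  (0 < M)%N -> M%:R = 0 :> R -> m <> n -> nilpotent_elt (x ^+ m - x ^+ n) ->
  periodic_elt x.
Proof.
move=> M0 MR; wlog nm : m n / (n < m)%N.
  move=> H mn nil; have /orP[nm|nm] : (n < m)%N || (m < n)%N.
    by rewrite -neq_ltn eq_sym; apply/eqP.
    exact: (H m n).
  apply: (H n m) => //; first exact: nesym.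
  case: nil => k E; exists k; rewrite -opprB -mulN1r exprMn_comm ?E ?mulr0 //.
  by rewrite /GRing.comm mulN1r mulrN1.
move=> mn [k uk]; set u := x ^+ m - x ^+ n in uk.
have [s0 s0S s0P] := prime_subring_seq M0 MR.
have xu : x * u = u * x by rewrite mulrBr mulrBl -!exprS -!exprSr.
have [|||s1 [s1S s01 s1u s1P]] := @adjoin_subring_seq _ s0 u k (fun=> 0) s0S.
- by move=> y sy; exists y => //; have [j ->] := (s0P y).1 sy;
    rewrite mulr_natl mulr_natr.
- by move=> _; apply: subring_seq0.
- by rewrite uk big1 // => i _; rewrite mul0r.
have [s11 _ _] := s1S; have s10 := subring_seq0 s1S.
have m0 : (0 < m)%N by apply: leq_ltn_trans nm.
(* The coefficients of [x ^+ m = x ^+ n + u], written as a sum of two terms so that the case [n = 0]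
   needs no separate treatment. *)
pose c (i : 'I_m) := (i == Ordinal nm)%:R + (if i == Ordinal m0 then u else 0).
have [|||s2 [s2S _ s2x _]] := @adjoin_subring_seq _ s1 x m c s1S.
- move=> y /[dup] sy /s1P[z sz yE]; exists y => //; rewrite yE mulr_sumr mulr_suml.
  apply: eq_bigr => i _; have [j ->] := (s0P (z i)).1 (sz i).
  have xui : GRing.comm x (u ^+ i) by apply: commrX.
  by rewrite !mulr_natl mulrnAr mulrnAl xui.
- by move=> i; apply: subring_seqD => //; case: eqP.
- under eq_bigr do rewrite mulrDl.
  rewrite big_split /= (bigD1 (Ordinal nm)) //= eqxx mul1r [X in _ + X + _]big1
    ?addr0.
    rewrite (bigD1 (Ordinal m0)) //= ?eqxx ?expr0 mulr1 big1 ?addr0 1?addrC ?subrK //.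
    by move=> i /negPf ->; rewrite mul0r.
  by move=> i /negPf ->; rewrite mul0r.
exact: subring_seq_periodic s2x.
Qed.

(** Adjoining the entries of [X] one by one to the prime subring gives a finite subring. All powers
    of [X] have their entries in it, so two of them coincide. *)
Lemma commutative_matrix_periodic (D : pzRingType) n :
  (forall x y : D, x * y = y * x) -> periodic_ring D -> periodic_ring 'M[D]_n.
Proof.
move=> comD perD; have [M M0 MD] := periodic_char perD.
apply/periodic_ringP => X.
have [s sS sX] : exists2 s, subring_seq s & forall i j, X i j \in s.
  have [s0 s0S _] := prime_subring_seq M0 MD.
  suff [s sS sX] : exists2 s, subring_seq s &
      forall k, k \in enum {: 'I_n * 'I_n} -> X k.1 k.2 \in s.
    by exists s => // i j; apply: (sX (i, j)); rewrite mem_enum.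
  elim: (enum _) => [|k t [s sS sX]]; first by exists s0.
  have [|V [VS sV Vg _]] := adjoin_periodic sS _
      ((periodic_ringP D).1 perD (X k.1 k.2)).
    by move=> x sx; exists x.
  exists V => // l; rewrite inE => /predU1P[-> //|lt]; exact/sV/sX.
have [s1 _ sM] := sS; have s0 := subring_seq0 sS.
have sXk k i j : (X ^+ k) i j \in s.
  elim: k i j => [|k IH] i j; first by rewrite mxE; case: eqP.
  by rewrite exprS mxE; apply: subring_seq_sum => // l; apply: (sM).
pose S : seq 'M[D]_n := [seq \matrix_(i, j) val (f (i, j))
  | f : {ffun 'I_n * 'I_n -> seq_sub s}].
have SX k : X ^+ k \in S.
  apply/mapP; exists [ffun ij => SeqSub (sXk k ij.1 ij.2)]; first by rewrite mem_enum.
  by apply/matrixP=> i j; rewrite mxE ffunE.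
have [k [l [kl E]]] := seq_collision SX.
exact: pow_collision E.
Qed.

(** * Commutativity of torsion division rings *)

(** Wedderburn's little theorem, applied after equipping the elements of [s] with the structure of a
    finite ring. *)
Lemma finite_domain_comm (D : nzRingType) (s : seq D) :
  subring_seq s -> (forall x y : D, x * y = 0 -> x = 0 \/ y = 0) ->
  {in s &, forall x y, x * y = y * x}.
Proof.
move=> [s1 sB sM] domD.
pose P : pred D := [in s].
have sR : subring_closed P by [].
pose T0 : subPzRingType P :=
  HB.pack (seq_sub s) (GRing.SubChoice_isSubPzRing.Build D P (seq_sub s) sR).
have T1 : (1 : T0) != 0.
  apply/eqP=> E; have /eqP := oner_neq0 D; apply.
  by rewrite -(rmorph1 (val : {rmorphism T0 -> D})) E rmorph0.
pose T2 : finNzRingType := HB.pack (seq_sub s) (GRing.SubPzRing.class T0)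
  (GRing.PzSemiRing_isNonZero.Build T0 T1).
pose T3 : finUnitRingType :=
  HB.pack (seq_sub s) (FinRing.NzRing.class T2) (FinRing.isNzRing.Build T2).
have valM (x y : T3) : val (x * y) = val x * val y by [].
have domT : GRing.integral_domain_axiom T3.
  move=> x y xy; have /domD[] : val x * val y = 0 by rewrite -valM xy.
    by move=> x0; apply/orP; left; apply/eqP/val_inj.
  by move=> x0; apply/orP; right; apply/eqP/val_inj.
move=> x y sx sy; have := finDomain_mulrC domT (SeqSub sx) (SeqSub sy).
by move/(congr1 val).
Qed.

Lemma torsion_domain (D : nzRingType) :
  (forall x : D, x = 0 \/ exists2 k, (0 < k)%N & x ^+ k = 1) ->
  forall x y : D, x * y = 0 -> x = 0 \/ y = 0.
Proof.
move=> tD x y xy; case: (tD x) => [->|[[//|k] _ xk]]; [by left|right].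
by rewrite -[y]mul1r -xk exprSr -mulrA xy mulr0.
Qed.

(** If [k = l * p], Frobenius gives [(a ^+ l - 1) ^+ p = a ^+ k - 1 = 0], so [a ^+ l = 1] against
    the minimality of [k]. *)
Lemma min_torsion_neq0 (D : nzRingType) p (a : D) k :
  p \in [pchar D] -> (0 < k)%N -> a ^+ k = 1 ->
  (forall l, (0 < l < k)%N -> a ^+ l <> 1) ->
  (forall x y : D, x * y = 0 -> x = 0 \/ y = 0) -> k%:R != 0 :> D.
Proof.
move=> pD k0 ak mink domD; apply/negP; rewrite -(dvdn_pcharf pD) => /dvdnP[l kE].
have pp := pcharf_prime pD.
have l0 : (0 < l)%N by move: k0; rewrite kE muln_gt0 => /andP[].
have lk : (l < k)%N by rewrite kE -[X in (X < _)%N]muln1 ltn_pmul2l // prime_gt1.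
apply: (mink l); first by rewrite l0.
have : (a ^+ l - 1) ^+ p = 0.
  rewrite -(pFrobenius_autE pD) pFrobenius_autB_comm; last exact: commr1.
  by rewrite pFrobenius_aut1 pFrobenius_autE -exprM -kE ak subrr.
elim: (p) => [/eqP|n IH]; first by rewrite oner_eq0.
rewrite exprS => /domD[/eqP|//]; by rewrite subr_eq0 => /eqP.
Qed.

(* Discrete Fourier analysis of conjugation by [a], whose [k]-th power is the
   identity, with the powers of [a] (acting on the left) as roots of unity:
   [w j] is the component of [k *: y] on which [v * a = a ^ - j * v]. *)
Lemma torsion_skew_eigenvector (D : nzRingType) p (a y : D) :
  p \in [pchar D] ->
  (forall x : D, x = 0 \/ exists2 k, (0 < k)%N & x ^+ k = 1) ->
  a * y <> y * a -> exists m (z : D), [/\ z * a = a ^+ m * z & a * z <> z * a].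
Proof.
move=> pD tD ay; have domD := torsion_domain tD.
have : exists k, (0 < k)%N && (a ^+ k == 1).
  case: (tD a) => [a0|[k k0 ak]]; first by case: ay; rewrite a0 mul0r mulr0.
  by exists k; rewrite k0 ak eqxx.
case/ex_minnP=> k /andP[k0 /eqP ak] kmin.
have mink l : (0 < l < k)%N -> a ^+ l <> 1.
  move=> /andP[l0 lk] al; have := kmin l; rewrite l0 al eqxx leqNgt lk.
  by move=> /(_ isT).
have kD := min_torsion_neq0 pD k0 ak mink domD.
pose w j := \sum_(i < k) a ^+ (i * j) * y * a ^+ i.
(* The product moves the summand of index [i] to index [i + 1]; the last one wraps around to the
   first since [a ^+ k = 1]. *)
have shift j : a ^+ j * w j * a = w j.
  rewrite /w mulr_sumr mulr_suml.
  have [k' kE] : exists k', k = k'.+1 by exists k.-1; rewrite prednK.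
  rewrite [in LHS]kE [in RHS]kE big_ord_recr big_ord_recl /= addrC; congr (_ + _).
    by rewrite mul0n !expr0 mulr1 mul1r !mulrA -exprD -mulSn -kE exprM ak expr1n
      mul1r -mulrA -exprSr -kE ak mulr1.
  apply: eq_bigr => i _.
  by rewrite !mulrA -exprD -mulSn -!mulrA -exprSr.
(* The exponent [k.-1 * j] stands for [- j] modulo [k]. *)
have wa j : w j * a = a ^+ (k.-1 * j) * w j.
  rewrite -[in RHS](shift j) !mulrA -exprD addnC -mulSn prednK // exprM ak expr1n.
  by rewrite mul1r.
(* After exchanging the sums, the geometric sum of the powers of [a ^+ i] vanishes for [i != 0],
   because [a ^+ i != 1] is a [k]-th root of unity in a domain. *)
have sumw : \sum_(j < k) w j = k%:R * y.
  rewrite exchange_big /=.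
  have [k' kE] : exists k', k = k'.+1 by exists k.-1; rewrite prednK.
  have E (i : 'I_k) : \sum_(j < k) a ^+ (i * j) * y * a ^+ i =
      (\sum_(j < k) (a ^+ i) ^+ j) * y * a ^+ i.
    by rewrite !mulr_suml; apply: eq_bigr => j _; rewrite exprM.
  under eq_bigr do rewrite E.
  rewrite (bigD1 (Ordinal k0)) //= [X in _ + X]big1 ?addr0 ?mulr1.
    by under eq_bigr do rewrite expr0 expr1n; rewrite sumr_const card_ord.
  move=> i i0; suff -> : \sum_(j < k) (a ^+ i) ^+ j = 0 by rewrite !mul0r.
  case: (domD (a ^+ i - 1) (\sum_(j < k) (a ^+ i) ^+ j)) => //.
    by rewrite -subrX1 -exprM mulnC exprM ak expr1n subrr.
  move=> /eqP; rewrite subr_eq0 => /eqP /mink; case.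
  by rewrite ltn_ord andbT lt0n.
apply: contrapT => noz.
(* If every component commuted with [a], so would [k%:R * y], and then [y], as [k%:R] is nonzero. *)
have w0 (j : 'I_k) : a * w j = w j * a.
  apply: contrapT => wj; apply: noz; exists (k.-1 * j)%N, (w j); split=> //.
apply: ay; have : k%:R * (a * y - y * a) = 0.
  rewrite mulrBr mulrA -[k%:R * a]commr_nat -mulrA [k%:R * (y * a)]mulrA -sumw.
  rewrite mulr_sumr mulr_suml -sumrB big1 // => j _; by rewrite w0 subrr.
by move=> /domD[/eqP|/eqP]; rewrite ?(negPf kD) // subr_eq0 => /eqP.
Qed.

(** Two noncommuting elements would give [z] with [z * a = a ^+ m * z] and [a * z <> z * a]. This
    relation makes the subring generated by [a] and [z] finite, and a finite domain is
    commutative. *)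
Lemma torsion_comm (D : nzRingType) p :
  p \in [pchar D] ->
  (forall x : D, x = 0 \/ exists2 k, (0 < k)%N & x ^+ k = 1) ->
  forall x y : D, x * y = y * x.
Proof.
move=> pD tD a y; apply: contrapT => ay.
have [m [z [za]]] := torsion_skew_eigenvector pD tD ay; apply.
have perD (x : D) : periodic_elt x.
  case: (tD x) => [->|[k k0 xk]]; first by apply: (@pow_collision _ _ 1 2);
    rewrite ?expr0n.
  by apply: (@pow_collision _ _ 0 k); [move=> k1; rewrite -k1 in k0|rewrite xk].
have [s0 s0S s0P] := prime_subring_seq (prime_gt0 (pcharf_prime pD)) (pcharf0 pD).
have [x /s0P[n ->]|s1 [s1S s01 s1a s1P]] := adjoin_periodic s0S _ (perD a).
  by exists n%:R; [apply/s0P; exists n|rewrite commr_nat].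
have [x /s1P[K [c [sc ->]]]|s2 [s2S s12 s2z _]] := adjoin_periodic s1S _ (perD z).
  exists (\sum_(i < K) c i * (a ^+ m) ^+ i).
    apply: subring_seq_sum => // i; have [_ _] := s1S; apply; first exact: s01.
    by apply: subring_seq_pow => //; apply: subring_seq_pow.
  rewrite mulr_sumr mulr_suml; apply: eq_bigr => i _.
  have [n ->] := (s0P (c i)).1 (sc i).
  rewrite mulrA commr_nat -!mulrA; congr (_ * _).
  elim: (i : nat) => [|j IH]; first by rewrite mulr1 mul1r.
  by rewrite exprSr mulrA IH -mulrA za !mulrA -exprSr.
by apply: (finite_domain_comm s2S (torsion_domain tD)) => //; apply: s12.
Qed.

(** * The upper nilradical and Koethe's conjecture *)

Lemma natr_mod (R : pzRingType) p n : p%:R = 0 :> R -> (n %% p)%:R = n%:R :> R.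
Proof. by move=> p0; rewrite {2}(divn_eq n p) natrD natrM p0 mulr0 add0r. Qed.

Definition nil_set (R : pzRingType) (I : set R) : Prop :=
  I `<=` @nilpotent_elt R.

Definition upper_nilradical (R : pzRingType) : set R :=
  [set x | exists I : set R, [/\ two_sided_ideal I, nil_set I & I x]].

Lemma nil_upper_nilradical (R : pzRingType) : nil_set (@upper_nilradical R).
Proof. by move=> x [I [_ nI Ix]]; apply: nI. Qed.

(** The sum of two nil ideals [I] and [J] is nil: if [z] is congruent modulo [J] to a nilpotent [a]
    in [I], some power of [z] lies in [J]. *)
Lemma upper_nilradical_ideal (R : pzRingType) : two_sided_ideal (@upper_nilradical R).
Proof.
split; [split|].
- exists [set 0]; split=> //; last by move=> _ ->; exists 1%N.
  split; last by move=> a x ->; rewrite /= mul0r.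
  by split=> [//|x y -> ->|a x ->]; rewrite /= ?subrr ?mulr0.
- move=> x y [I [[idI Ir] nI Ix]] [J [[idJ Jr] nJ Jy]].
  have [I0 IB Il] := idI; have [J0 JB Jl] := idJ.
  pose K := [set z | exists2 a, I a & J (z - a)].
  have idK : two_sided_ideal K.
    split; [split|].
    + by exists 0 => //; rewrite subr0.
    + move=> z w [a Ia Ja] [b Ib Jb]; exists (a - b); first exact: IB.
      have -> : z - w - (a - b) = (z - a) - (w - b).
        by rewrite !opprB [b - a]addrC addrACA [- w + b]addrC.
      exact: JB.
    + by move=> c z [a Ia Ja]; exists (c * a); [exact: Il|rewrite -mulrBr; exact: Jl].
    + by move=> c z [a Ia Ja]; exists (a * c); [exact: Ir|rewrite -mulrBl; exact: Jr].
  exists K; split=> //; last first.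
    by exists x => //; rewrite [x - y]addrC addrK; apply: left_idealN.
  move=> z [a Ia Jza]; have [k ak] := nI _ Ia.
  have : J (z ^+ k - a ^+ k).
    elim: k {ak} => [|k IH]; first by rewrite subrr.
    have -> : z ^+ k.+1 - a ^+ k.+1 = z * (z ^+ k - a ^+ k) + (z - a) * a ^+ k.
      by rewrite !exprS mulrBr mulrBl addrA subrK.
    by apply: left_idealD => //; [exact: Jl|exact: Jr].
  by rewrite ak subr0 => /nJ [l]; rewrite -exprM => zl; exists (k * l)%N.
- by move=> a x [I [[idI Ir] nI Ix]]; exists I; split=> //; have [_ _] := idI; apply.
- by move=> a x [I [[idI Ir] nI Ix]]; exists I; split=> //; apply: Ir.
Qed.

(** Applied to [c = p%:R], this makes the quotient by the upper nilradical an algebra over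
    ['F_p]. *)
Lemma central_nilpotent_upper_nilradical (R : pzRingType) (c : R) :
  (forall x, c * x = x * c) -> nilpotent_elt c -> upper_nilradical c.
Proof.
move=> cc [r cr]; exists [set c * y | y in setT]; split; last by exists 1;
  rewrite ?mulr1.
  split; last by move=> a _ [y _ <-]; exists (y * a); rewrite ?mulrA.
  split; first by exists 0; rewrite ?mulr0.
    by move=> _ _ [y _ <-] [z _ <-]; exists (y - z); rewrite ?mulrBr.
  by move=> a _ [y _ <-]; exists (a * y); rewrite // !mulrA cc.
by move=> _ [y _ <-]; exists r; rewrite exprMn_comm ?cr ?mul0r.
Qed.

(** The quotient of [S] by its upper nilradical is an ['F_p]-algebra without nonzero nil ideals, so
    the conjecture sends the image of [L] to zero. *)
Lemma kothe_nil_left_ideal (S : pzRingType) p (L : set S) :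
  prime p -> nilpotent_elt (p%:R : S) -> kothe_conjecture 'F_p ->
  left_ideal L -> nil_set L -> L `<=` @upper_nilradical S.
Proof.
move=> pp pS kothe idL nL.
have [Q [f [fsurj fU]]] := quotient_ring_exists (upper_nilradical_ideal S).
have pQ : p%:R = 0 :> Q.
  rewrite -(rmorph_nat f); apply/fU/central_nilpotent_upper_nilradical => // x.
  by rewrite commr_nat.
(* Casting the natural representative of [a : 'F_p] into [Q] respects sums and products because
   [p%:R = 0] there. *)
have valD (a b : 'F_p) : ((a + b)%R : 'F_p)%:R = a%:R + b%:R :> Q.
  by rewrite /= [X in (_ %% X)%N](Fp_cast pp) natr_mod ?natrD.
have valM (a b : 'F_p) : ((a * b)%R : 'F_p)%:R = a%:R * b%:R :> Q.
  by rewrite /= [X in (_ %% X)%N](Fp_cast pp) natr_mod ?natrM.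
pose sc (a : 'F_p) (x : Q) : Q := a%:R * x.
have scA a b x : sc a (sc b x) = sc (a * b) x by rewrite /sc valM mulrA.
have sc1 : left_id 1 sc by move=> x; rewrite /sc mul1r.
have scDr : right_distributive sc +%R by move=> a x y; rewrite /sc mulrDr.
have scDl x : {morph sc^~ x : a b / a + b} by move=> a b; rewrite /sc valD mulrDl.
pose V : lmodType 'F_p := HB.pack (GRing.PzRing.sort Q)
  (GRing.Zmodule_isLmodule.Build 'F_p Q scA sc1 scDr scDl).
pose mu (x y : V) : V := (x : Q) * (y : Q).
have muA : associative mu by move=> x y z; apply: mulrA.
have muDl : left_distributive mu +%R by move=> x y z; apply: mulrDl.
have muDr : right_distributive mu +%R by move=> x y z; apply: mulrDr.
have muZl (a : 'F_p) (x y : V) : a *: mu x y = mu (a *: x) y by apply: mulrA.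
have muZr (a : 'F_p) (x y : V) : a *: mu x y = mu x (a *: y).
  by rewrite /mu /GRing.scale /= /sc !mulrA commr_nat.
pose A : nuAlgebra 'F_p := NuAlgebra muA muDl muDr muZl muZr.
have powE (x : A) n : nu_powS x n = (x : Q) ^+ n.+1.
  by elim: n => [|n IH] //; rewrite exprS -IH.
have ZE (a : 'F_p) (x : A) : a *: x = (a%:R : Q) * x by [].
have noNil (I : set A) : nu_ideal I -> nu_nil I -> I = [set 0].
  move=> [[[I0 IZ] Il] [_ Ir]] nI.
  (* The preimage of [I] in [S] is nil: a power of each element falls into the upper nilradical,
     which is itself nil. *)
  have J (x : S) : I (f x) -> f x = 0.
    move=> Ix; apply/fU; exists [set z | I (f z)]; split=> //.
      split; last by move=> a z /= Iz; rewrite rmorphM; apply: Ir.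
      split; first by rewrite /= rmorph0.
        move=> z w /= Iz Iw; rewrite rmorphB addrC.
        have -> : - f w + f z = ((-1 : 'F_p) *: (f w : A) + (f z : A)).
          by rewrite scaleN1r.
        exact: IZ.
      by move=> a z /= Iz; rewrite rmorphM; apply: Il.
    move=> z /= /nI [n]; rewrite powE -rmorphXn => /fU/nil_upper_nilradical[k].
    by rewrite -exprM; exists (n.+1 * k)%N.
  apply/seteqP; split=> y; last by move=> ->.
  by have [x <-] := fsurj y => /J.
have [L0 LB Ll] := idL.
have imL : [set y : A | exists2 x, L x & y = f x] = [set 0].
  apply: (kothe A noNil).
    left; split; [split|].
    - by exists 0; rewrite ?rmorph0.
    - move=> a _ _ [x Lx ->] [y Ly ->]; exists (a%:R * x + y).
        by apply: left_idealD => //; apply: Ll.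
      by rewrite rmorphD rmorphM rmorph_nat.
    - move=> b _ [x Lx ->]; have [c <-] := fsurj b.
      by exists (c * x); [exact: Ll|rewrite rmorphM].
  move=> _ [x Lx ->]; have [k xk] := nL _ Lx.
  by exists k; rewrite powE -rmorphXn exprS xk mulr0 rmorph0.
move=> x Lx; apply/fU;
have : [set y : A | exists2 x, L x & y = f x] (f x) by exists x.
by rewrite imL.
Qed.

(** Take the least positive [p] whose image is nilpotent. In a proper factorization both factors
    would have finite order, and so would their product. *)
Lemma nil_or_torsion_char (R : pzRingType) : nil_or_torsion R ->
  exists2 p, prime p & nilpotent_elt (p%:R : R).
Proof.
move=> tR; have [R1 RP] := tR.
have [M M0 MR] := periodic_char (nil_or_torsion_periodic tR).
have : exists n, (0 < n)%N && `[< nilpotent_elt (n%:R : R) >].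
  by exists M; rewrite M0 MR; apply/asboolP; exists 1%N.
case/ex_minnP=> p /andP[p0 /asboolP np] minp.
have tors n : (0 < n < p)%N -> exists2 k, (0 < k)%N & (n%:R : R) ^+ k = 1.
  move=> /andP[n0 np']; case: (RP n%:R) => // nn; move: np'.
  by rewrite ltnNge minp // n0; apply/asboolP.
exists p => //; apply/primeP; split.
  rewrite ltn_neqAle eq_sym p0 andbT; apply/eqP=> p1.
  by apply: (nilpotent_nlinv R1 (mulr1 1)); move: np; rewrite p1.
move=> d dp; have [//|d1] := eqVneq d 1%N; have [//|dnp] := eqVneq d p.
have d0 : (0 < d)%N by apply: dvdn_gt0 dp.
have dltp : (d < p)%N by rewrite ltn_neqAle dnp dvdn_leq.
have pE : p = (p %/ d * d)%N by rewrite divnK.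
have [|k k0 dk] := tors d; first by rewrite d0.
have [|l l0 el] := tors (p %/ d)%N.
  by rewrite divn_gt0 // dvdn_leq // ltn_Pdiv // ltn_neqAle eq_sym d1.
case: np => j; rewrite pE natrM => pj; exfalso; apply: R1.
have <- : ((p %/ d)%:R * d%:R : R) ^+ (j * (k * l)) = 1.
  rewrite mulnC exprM exprMn_comm; last exact: commr_nat.
  by rewrite [d%:R ^+ _]exprM dk expr1n mulr1 [(k * l)%N]mulnC exprM el !expr1n.
by rewrite exprM pj expr0n gtn_eqF // muln_gt0 k0.
Qed.

Lemma nil_matrix2 (R : pzRingType) p :
  prime p -> nilpotent_elt (p%:R : R) -> kothe_conjecture 'F_p ->
  two_sided_ideal (@nilpotent_elt R) ->
  forall X : 'M[R]_2, (forall i j, nilpotent_elt (X i j)) -> nilpotent_elt X.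
Proof.
move=> pp [r pr] kothe [[N0 NB Nl] Nr] X NX.
have ND (x y : R) : nilpotent_elt x -> nilpotent_elt y -> nilpotent_elt (x + y).
  exact: (@left_idealD R (@nilpotent_elt R)).
pose i1 : 'I_2 := lift ord0 ord0.
have ord2P (i : 'I_2) : i = ord0 \/ i = i1.
  by case: (unliftP ord0 i) => [k ->|->]; [right; rewrite (ord1 k)|left].
pose L : set 'M[R]_2 := [set Y | forall i, nilpotent_elt (Y i ord0) /\ Y i i1 = 0].
have idL : left_ideal L.
  split.
  - by move=> i; rewrite !mxE.
  - move=> Y Z LY LZ i; rewrite !mxE; have [? ->] := LY i; have [? ->] := LZ i.
    by rewrite subrr; split=> //; apply: NB.
  - move=> A Y LY i; rewrite !mxE !big_ord_recl !big_ord0 !addr0; split.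
      by apply: ND; apply: Nl; exact: (LY _).1.
    by rewrite (LY _).2 (LY _).2 !mulr0 addr0.
have nL : nil_set L.
  (* With a zero second column, squaring [Y] amounts to multiplying it on the right by its corner
     entry, which is nilpotent. *)
  move=> Y LY; have YY : Y * Y = Y *m (Y ord0 ord0)%:M.
    apply/matrixP=> i j; rewrite !mxE !big_ord_recl !big_ord0 !addr0 !mxE.
    by rewrite (LY i).2 !mul0r !addr0; case: (ord2P j) => -> //=; rewrite (LY _).2.
  have Yk k : Y ^+ k.+1 = Y *m (Y ord0 ord0 ^+ k)%:M.
    elim: k => [|k IH]; first by rewrite mulmx1.
    rewrite exprS IH; transitivity ((Y * Y) *m (Y ord0 ord0 ^+ k)%:M);
      first exact: mulmxA.
    by rewrite YY -mulmxA -scalar_mxM exprS.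
  have [k ak] := (LY ord0).1; exists k.+1; rewrite Yk ak.
  by rewrite raddf0 mulmx0.
have pS : nilpotent_elt (p%:R : 'M[R]_2).
  by exists r; rewrite -natrX -(rmorph_nat (@scalar_mx R 2)) natrX pr rmorph0.
have LU := kothe_nil_left_ideal pp pS kothe idL nL.
have [idU Ur] := upper_nilradical_ideal 'M[R]_2.
apply: nil_upper_nilradical.
have deltaE (i j k : 'I_2) (Y : 'M[R]_2) l :
  (Y * delta_mx i j) k l = Y k i *+ (l == j).
  rewrite mxE (bigD1 i) //= mxE eqxx /= big1 ?addr0 => [|m /negPf mi].
    by rewrite mulr_natr.
  by rewrite mxE mi mulr0.
(* The second column is moved to the first, where it gives an element of [L], and then moved back by
   right multiplication. *)
have -> : X = X * delta_mx ord0 ord0 + (X * delta_mx i1 ord0) * delta_mx ord0 i1.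
  apply/matrixP=> i j; rewrite [in RHS]mxE !deltaE eqxx.
  by case: (ord2P j) => ->; rewrite ?addr0 ?add0r.
by apply: left_idealD => //; [|apply: Ur]; apply: LU => i; rewrite !deltaE;
  split=> //; exact: NX.
Qed.

Lemma local_periodic_of_kothe (R : pzRingType) :
  (forall F : finFieldType, kothe_conjecture F) ->
  periodic_ring R -> local_ring R -> periodic_ring 'M[R]_2.
Proof.
move=> kothe perR /(local_nil_or_torsion perR) tR; have [R1 RP] := tR.
have [p pp np] := nil_or_torsion_char tR.
have idN := nilpotent_two_sided tR.
have [D0 [f [fsurj fN]]] := quotient_ring_exists idN.
have D1 : (1 : D0) != 0.
  apply/eqP; rewrite -(rmorph1 f) => /fN; exact: (nilpotent_nlinv R1 (mulr1 1)).
pose D : nzRingType := HB.pack (GRing.PzRing.sort D0)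
  (GRing.PzSemiRing_isNonZero.Build D0 D1).
have tD (x : D) : x = 0 \/ exists2 k, (0 < k)%N & x ^+ k = 1.
  have [y <-] := fsurj x; case: (RP y) => [/fN|[k k0 yk]]; first by left.
  by right; exists k => //; rewrite -(rmorphXn f) yk rmorph1.
have pD : p \in [pchar D].
  by apply/andP; split=> //; apply/eqP; rewrite -(rmorph_nat f); apply/fN.
have comD (x y : D0) : x * y = y * x := torsion_comm pD tD x y.
have perD : periodic_ring D0.
  apply: nil_or_torsion_periodic; split=> [|x]; first exact/eqP.
  by case: (tD x) => [->|]; [left; exists 1%N|right].
have [M M0 MR] := periodic_char perR.
have MX : M%:R = 0 :> 'M[R]_2 by rewrite -(rmorph_nat (@scalar_mx R 2)) MR rmorph0.
apply/periodic_ringP => X.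
have [m [n [_ _ mn E]]] := commutative_matrix_periodic comD perD (map_mx f X).
apply: (periodic_of_nilpotent_diff M0 MX mn).
apply: (nil_matrix2 pp np (kothe _) idN); apply/(map_mx_eq0_entries _ fN).
by rewrite map_mxB !map_mxX E subrr.
Qed.

(** * Unitization of nil left ideals *)

(** Gaussian elimination on [1 - Z]: [1 - Z ord0 ord0] is a unit, and eliminating the first row of
    [V] leaves a coefficient in [L], hence nilpotent, that fixes the second row. Nilpotency of [Z]
    itself is not assumed. *)
Lemma nil_left_ideal_fixed0 (S : pzRingType) (L : set S) (Z V : 'M[S]_2) :
  left_ideal L -> nil_set L -> (forall i j, L (Z i j)) -> Z * V = V -> V = 0.
Proof.
move=> idL nL LZ ZV; have [_ _ Ll] := idL; pose i1 : 'I_2 := lift ord0 ord0.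
have E i j : Z i ord0 * V ord0 j + Z i i1 * V i1 j = V i j.
  by rewrite -[in RHS]ZV mxE !big_ord_recl big_ord0 addr0.
have [u u1 _] := nilpotent_unit (nL _ (LZ ord0 ord0)).
have V0 j : V ord0 j = u * Z ord0 i1 * V i1 j.
  rewrite -[LHS]mul1r -[X in X * _]u1 -!mulrA mulrBl mul1r; congr (_ * _).
  by rewrite -{1}(E ord0 j) [_ + Z ord0 i1 * _]addrC addrK.
have V1 j : V i1 j = 0.
  apply: (@nilpotent_fixed0 _ (Z i1 ord0 * (u * Z ord0 i1) + Z i1 i1)).
    apply: nL; apply: left_idealD => //; apply: (Ll); exact: Ll.
  by rewrite mulrDl -mulrA -V0 E.
apply/matrixP=> i j; rewrite [RHS]mxE; case: (unliftP ord0 i) => [k ->|->].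
  by rewrite (ord1 k) V1.
by rewrite V0 V1 mulr0.
Qed.

Lemma nu_mul0r (F : fieldType) (A : nuAlgebra F) (x : A) : nu_mul 0 x = 0.
Proof. by apply: (@addrI _ (nu_mul 0 x)); rewrite -nu_mulDl !addr0. Qed.

Lemma nu_mulr0 (F : fieldType) (A : nuAlgebra F) (x : A) : nu_mul x 0 = 0.
Proof. by apply: (@addrI _ (nu_mul x 0)); rewrite -nu_mulDr !addr0. Qed.

(** The Dorroh unitization on [F * A]; [i a x] stands for the formal sum [a + x]. *)
Lemma unitization_exists (F : fieldType) (A : nuAlgebra F) :
  exists (S : pzRingType) (i : F -> A -> S),
  [/\ forall s, exists a x, s = i a x,
      forall a b x y, i a x = i b y -> a = b /\ x = y,
      forall a b x y, i (a - b) (x - y) = i a x - i b y,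
      i 1 0 = 1 &
      forall a b x y, i a x * i b y = i (a * b) (a *: y + b *: x + nu_mul x y)].
Proof.
pose T : zmodType := (F * A)%type.
pose m (s t : T) : T := (s.1 * t.1, s.1 *: t.2 + t.1 *: s.2 + nu_mul s.2 t.2).
have mA : associative m.
  move=> [a x] [b y] [c z]; congr pair => /=; first exact: mulrA.
  rewrite !scalerDr !nu_mulDr !nu_mulDl !scalerA -!nu_scaleAl -!nu_scaleAr nu_mulA.
  rewrite !addrA [c * a]mulrC [c * b]mulrC.
  by rewrite [LHS](ACl (1*2*4*6*3*5*7)).
have m1 : left_id (1, 0) m.
  by move=> [a x]; rewrite /m /= mul1r scale1r scaler0 nu_mul0r !addr0.
have mr1 : right_id (1, 0) m.
  by move=> [a x]; rewrite /m /= mulr1 scale1r scaler0 nu_mulr0 add0r addr0.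
have mDl : left_distributive m +%R.
  move=> [a x] [b y] [c z]; congr pair => /=; first exact: mulrDl.
  by rewrite scalerDl scalerDr nu_mulDl !addrA [LHS](ACl (1*3*5*2*4*6)).
have mDr : right_distributive m +%R.
  move=> [a x] [b y] [c z]; congr pair => /=; first exact: mulrDr.
  by rewrite scalerDl scalerDr nu_mulDr !addrA [LHS](ACl (1*3*5*2*4*6)).
pose S : pzRingType := HB.pack (GRing.Zmodule.sort T)
  (GRing.Zmodule_isPzRing.Build T mA m1 mr1 mDl mDr).
exists S, (fun a x => (a, x)); split=> //; first by move=> [a x]; exists a, x.
by move=> a b x y [].
Qed.

Lemma nil_left_ideal_addM (F : finFieldType) (A : nuAlgebra F) (L : set A)
    (a x0 x1 : A) :
  (forall R : pzRingType, periodic_ring R -> local_ring R -> periodic_ring 'M[R]_2) ->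
  nu_left_ideal L -> nu_nil L -> L x0 -> L x1 -> nu_nilpotent (x0 + nu_mul x1 a).
Proof.
move=> H [[L0 LZ] Ll] nL Lx0 Lx1.
have LD x y : L x -> L y -> L (x + y) by move=> Lx Ly; rewrite -[x]scale1r; apply: LZ.
have LN x : L x -> L (- x) by move=> Lx; rewrite -scaleN1r -[_ *: _]addr0; apply: LZ.
have LS b x : L x -> L (b *: x) by move=> Lx; rewrite -[_ *: _]addr0; apply: LZ.
have [S [i [isurj iinj iB i1 iM]]] := unitization_exists A.
have i0 : i 0 0 = 0 by rewrite -[X in i X _](subrr 0) -[X in i _ X](subrr 0) iB subrr.
have iN b x : i (- b) (- x) = - i b x by rewrite -[- b]sub0r -[- x]sub0r iB i0 sub0r.
have iD b c x y : i (b + c) (x + y) = i b x + i c y.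
  by rewrite -[c in LHS]opprK -[y in LHS]opprK iB iN opprK.
have iX x n : (i 0 x) ^+ n.+1 = i 0 (nu_powS x n).
  elim: n => [|n IH] //; rewrite exprS IH iM !mul0r !scale0r !add0r //.
have inil x : nu_nilpotent x <-> nilpotent_elt (i 0 x).
  split=> [[n xn]|[n xn]]; first by exists n.+1; rewrite iX xn.
  by exists n; have [] := iinj 0 0 (nu_powS x n) 0 => //;
    rewrite -iX exprS xn mulr0 i0.
pose P : set S := [set s | exists c x, L x /\ s = i c x].
have PB s t : P s -> P t -> P (s - t).
  move=> [c [x [Lx ->]]] [d [y [Ly ->]]]; exists (c - d), (x - y); split;
    last by rewrite iB.
  by apply/LD/LN.
have PM s t : P s -> P t -> P (s * t).
  move=> [c [x [Lx ->]]] [d [y [Ly ->]]]; rewrite iM; eexists; eexists; split;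
    last by [].
  by apply: (LD); [apply: LD; apply: LS|apply: Ll].
have [|Q [iota [iotaI PQ]]] := subring_exists _ PB PM; first by exists 1, 0.
have nP x : L x -> nilpotent_elt (i 0 x) by move=> /nL /inil.
have iXc c x k : L x -> exists2 y, L y & (i c x) ^+ k = i (c ^+ k) y.
  move=> Lx; elim: k => [|k [y Ly E]]; first by exists 0.
  rewrite exprS E iM exprS; eexists; last by [].
  by apply: (LD); [apply: LD; apply: LS|apply: Ll].
have tQ : nil_or_torsion Q.
  split=> [Q1|q].
    have := congr1 iota Q1; rewrite rmorph1 rmorph0 -i1 -i0 => /iinj[/eqP].
    by rewrite oner_eq0.
  have /PQ [c [x [Lx qE]]] : exists q', iota q' = iota q by exists q.
  have [c0|c0] := eqVneq c 0.
    have [k xk] := nP _ Lx; left; exists k; apply: iotaI.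
    by rewrite rmorphXn rmorph0 qE c0.
  (* The copy of the finite field [F]. Adjoining the nilpotent [x] keeps it finite, so [c + x] is
     periodic. *)
  pose s0 : seq S := [seq i b 0 | b : F].
  have s0P b : i b 0 \in s0 by apply/mapP; exists b; rewrite ?mem_enum.
  have s0S : subring_seq s0.
    split; first by rewrite -i1.
      by move=> _ _ /mapP[b _ ->] /mapP[d _ ->]; rewrite -iB subr0.
    move=> _ _ /mapP[b _ ->] /mapP[d _ ->]; rewrite iM !scaler0 !add0r.
    rewrite nu_mul0r; exact: s0P.
  have [K xK] := nP _ Lx.
  have [|||V [VS sV Vx _]] := @adjoin_subring_seq _ s0 (i 0 x) K (fun=> 0) s0S.
  - move=> _ /mapP[b _ ->]; exists (i b 0) => //; rewrite !iM.
    by rewrite !scale0r mul0r mulr0 nu_mul0r nu_mulr0 !addr0 !add0r.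
  - by move=> _; apply: subring_seq0.
  - by rewrite xK big1 // => j _; rewrite mul0r.
  have perx : periodic_elt (i c x).
    apply: (subring_seq_periodic VS); rewrite -[c]addr0 -[x]add0r iD.
    by apply: subring_seqD => //; apply: sV.
  (* The idempotent power is [c ^+ k + y] with [y] in [L]. Its scalar part is a nonzero idempotent
     of [F], hence 1; then [- y] is idempotent and nilpotent, hence 0. *)
  have [k k0 ek] := idempotent_pow perx; right; exists k => //; apply: iotaI.
  rewrite rmorphXn rmorph1 qE; have [y Ly eE] := iXc c x k Lx.
  rewrite eE in ek *.
  have c1 : c ^+ k = 1.
    move: ek; rewrite iM => /iinj[/eqP]; rewrite -subr_eq0 -[X in _ - X]mulr1 -mulrBr.
    by rewrite mulf_eq0 expf_eq0 (negPf c0) andbF /= subr_eq0 => /eqP.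
  rewrite c1 in ek *.
  have wE : 1 - i 1 y = i 0 (- y) by rewrite -i1 -iB subrr sub0r.
  have /eqP : 1 - i 1 y = 0.
    apply: (@nilpotent_fixed0 _ (1 - i 1 y)); first by rewrite wE; apply/nP/LN.
    by rewrite mulrBl mul1r mulrBr mulr1 ek subrr subr0.
  by rewrite subr_eq0 => /eqP.
have perM := H _ (nil_or_torsion_periodic tQ) (nil_or_torsion_local tQ).
pose L' : set S := [set s | exists2 x, L x & s = i 0 x].
have idL' : left_ideal L'.
  split; first by exists 0.
    by move=> _ _ [x Lx ->] [y Ly ->]; exists (x - y);
      [apply/LD/LN|rewrite -iB subr0].
  move=> s _ [x Lx ->]; have [b [y ->]] := isurj s; rewrite iM mulr0 scale0r addr0.
  by eexists; last by []; apply: LD; [apply: LS|apply: Ll].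
have nL' : nil_set L' by move=> _ [x Lx ->]; apply: nP.
have [_ _ L'l] := idL'.
have L'sum (f : 'I_2 -> S) : (forall j, L' (f j)) -> L' (\sum_j f j).
  move=> Lf; apply: (big_ind L') => //; first by case: idL'.
  by move=> s t; apply: left_idealD.
pose alpha := i 0 a.
pose v (j : 'I_2) := if j == ord0 then 1 else alpha.
(* The column [(1, a)] times the row [(x0, x1)]; the entries stay in [L'] because it is a left
   ideal. *)
pose Y : 'M[S]_2 := \matrix_(j, l) (v j * (if l == ord0 then i 0 x0 else i 0 x1)).
have L'Y j l : L' (Y j l).
  by rewrite mxE; apply: L'l; case: ifP => _; [exists x0|exists x1].
have [Y' Y'E] : exists Y', map_mx iota Y' = Y.
  have /choice [g gE] : forall jl : 'I_2 * 'I_2, exists q, iota q = Y jl.1 jl.2.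
    by move=> jl; apply/PQ; have [x Lx ->] := L'Y jl.1 jl.2; exists 0, x.
  by exists (\matrix_(j, l) g (j, l)); apply/matrixP=> j l; rewrite !mxE gE /= mxE.
have [m [d [m0 d0 E]]] := (periodic_ringP _).1 perM Y'; case: d d0 E => // d _ E.
(* Periodicity says that [Y ^+ d.+1], which has entries in [L'], fixes [Y ^+ m]. *)
have Ym : Y ^+ m = 0.
  apply: (@nil_left_ideal_fixed0 _ L' (Y ^+ d.+1)) => //.
    by move=> j l; rewrite exprSr mxE; apply: L'sum => n; apply: L'l.
  by rewrite -exprD addnC -Y'E -!map_mxX -E.
pose t := i 0 (x0 + nu_mul x1 a).
pose V : 'cV[S]_2 := \col_j v j.
(* The row times the column is [t], so [Y] acts on [V] as right multiplication by [t]. The first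
   entry of [V] is 1, so [Y ^+ m = 0] forces [t ^+ m = 0]. *)
have YV k : Y ^+ k *m V = V *m (t ^+ k)%:M.
  elim: k => [|k IH]; first by rewrite expr0 mul1mx mulmx1.
  rewrite exprSr -[Y ^+ k * Y]/(Y ^+ k *m Y) -mulmxA.
  have -> : Y *m V = V *m t%:M.
    apply/matrixP=> j l; rewrite !mxE !big_ord_recl !big_ord0 !addr0 !mxE (ord1 l).
    rewrite eqxx mulr1n /v /= mulr1 -mulrA -mulrDr; congr (_ * _).
    by rewrite /t /alpha iM !scale0r !mul0r !add0r -iD addr0.
  by rewrite mulmxA IH -mulmxA -scalar_mxM exprSr.
apply/inil; exists m; have := YV m; rewrite Ym mul0mx => /matrixP/(_ ord0 ord0).
by rewrite !mxE big_ord_recl big_ord0 addr0 !mxE /v eqxx mul1r mulr1n.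
Qed.

(** * One-sided nil ideals of algebras over finite fields *)

Lemma kothe_left (F : finFieldType) (A : nuAlgebra F) (L : set A) :
  (forall R : pzRingType, periodic_ring R -> local_ring R -> periodic_ring 'M[R]_2) ->
  (forall I : set A, nu_ideal I -> nu_nil I -> I = [set 0]) ->
  nu_left_ideal L -> nu_nil L -> L = [set 0].
Proof.
move=> H noNil idL nL.
have [||M [[idM nM] LM maxM]] :=
    @Zorn_above _ [set I : set A | nu_left_ideal I /\ nu_nil I] L.
- by [].
- move=> C [J0 CJ0] CP Ctot; split; last by move=> x [J CJ]; apply: (CP _ CJ).2.
  split; last by move=> a x [J CJ Jx]; exists J => //; apply: (CP _ CJ).1.2.
  split; first by exists J0 => //; apply: (CP _ CJ0).1.1.1.
  move=> a x y [J CJ Jx] [K CK Ky].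
  case: (Ctot _ _ CJ CK) => S; [exists K|exists J] => //.
    by apply: (CP _ CK).1.1.2 => //; apply: S.
  by apply: (CP _ CJ).1.1.2 => //; apply: S.
have [[M0 MZ] Ml] := idM.
have Mr a x : M x -> M (nu_mul x a).
  (* The nil left ideal [M + Ma] contains [M], so maximality gives equality. *)
  move=> Mx; pose M' := [set z |
    exists x0 x1, [/\ M x0, M x1 & z = x0 + nu_mul x1 a]].
  rewrite -(maxM M').
  - by exists 0, x; rewrite add0r.
  - by move=> y My; exists y, 0; rewrite nu_mul0r addr0.
  - split; last first.
      by move=> _ [x0 [x1 [Mx0 Mx1 ->]]]; apply: (@nil_left_ideal_addM F A M).
    split; first split.
    + by exists 0, 0; rewrite nu_mul0r addr0.
    + move=> b _ _ [x0 [x1 [Mx0 Mx1 ->]]] [y0 [y1 [My0 My1 ->]]].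
      exists (b *: x0 + y0), (b *: x1 + y1).
      by rewrite scalerDr nu_scaleAl nu_mulDl addrACA; split=> //; apply: MZ.
    + move=> b _ [x0 [x1 [Mx0 Mx1 ->]]]; exists (nu_mul b x0), (nu_mul b x1).
      by rewrite nu_mulDr nu_mulA; split=> //; apply: Ml.
have ME : M = [set 0] by apply: noNil => //; split=> //; split.
apply/seteqP; split=> [x /LM|_ ->]; first by rewrite ME.
exact: idL.1.1.
Qed.

(** Turns right ideals into left ideals, with the same two-sided ideals and the same nilpotent
    elements. *)
Definition opposite_algebra (F : fieldType) (A : nuAlgebra F) : nuAlgebra F :=
  @NuAlgebra F A (fun x y => nu_mul y x) (fun x y z => esym (nu_mulA z y x))
    (fun x y z => nu_mulDr z x y) (fun x y z => nu_mulDl y z x)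
    (fun a x y => nu_scaleAr a y x) (fun a x y => nu_scaleAl a y x).

Lemma nu_powSr (F : fieldType) (A : nuAlgebra F) (x : A) n :
  nu_mul (nu_powS x n) x = nu_powS x n.+1.
Proof. by elim: n => //= n IH; rewrite -nu_mulA IH. Qed.

Lemma opposite_powS (F : fieldType) (A : nuAlgebra F) (x : A) n :
  @nu_powS F (opposite_algebra A) x n = nu_powS x n.
Proof. by elim: n => // n IH; rewrite -[RHS]nu_powSr -[in RHS]IH. Qed.

Lemma opposite_nil (F : fieldType) (A : nuAlgebra F) (I : set A) :
  @nu_nil F (opposite_algebra A) I <-> nu_nil I.
Proof.
by split=> nI x /nI[n xn]; exists n; [rewrite -opposite_powS|rewrite opposite_powS].
Qed.

Lemma kothe_of_local_periodic (F : finFieldType) :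
  (forall R : pzRingType, periodic_ring R -> local_ring R -> periodic_ring 'M[R]_2) ->
  kothe_conjecture F.
Proof.
move=> H A noNil I [|idI] nI; first by move=> idI; apply: kothe_left.
apply: (@kothe_left F (opposite_algebra A) I) => //; last exact/opposite_nil.
by move=> J [lJ rJ] /opposite_nil nJ; apply: noNil.
Qed.

Lemma local_abelian (R : pzRingType) :
  periodic_ring R -> local_ring R -> abelian_ring R.
Proof.
move=> perR /(local_nil_or_torsion perR) tR e ee x.
by case: (nil_or_torsion_idempotent tR ee) => ->; rewrite ?mul0r ?mulr0 ?mul1r ?mulr1.
Qed.

Theorem theorem2p20 :
  ((forall R : pzRingType,
      periodic_ring R -> abelian_ring R -> periodic_ring 'M[R]_2) <->
   (forall R : pzRingType,
      periodic_ring R -> local_ring R -> periodic_ring 'M[R]_2)) /\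
  ((forall R : pzRingType,
      periodic_ring R -> local_ring R -> periodic_ring 'M[R]_2) <->
   (forall F : finFieldType, kothe_conjecture F)).
Proof.
split; split.
- by move=> H R perR locR; apply: H => //; apply: local_abelian.
- by move=> H R; apply: periodic_abelian_of_local.
- by move=> H F; apply: kothe_of_local_periodic.
- by move=> kothe R; apply: local_periodic_of_kothe.
Qed.
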